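(* Let $n,m,s\ge 2$, let $G_1=B(n,m,s)$ be the double broom graph on the vertex set $V(G_1)=\{x_1,\ldots,x_n,y_1,\ldots,y_m,z_1,\ldots,z_s\}$, and let $NI(G_1^2)\subset S=K[V(G_1)]$ be the closed neighborhood ideal of the square of $G_1$. If $m-4=6p_1+d_1$ with $p_1\geq 0$ and $0\leq d_1\leq 5$, then $$\operatorname{reg}\frac{S}{NI(G_1^2)}=\begin{cases} 4p_1+s+n+2, & d_1\in\{0,1\}\\ 4p_1+s+n+3, & d_1=2\\ 4p_1+s+n+4, & d_1\in\{3,4\}\\ 4p_1+s+n+5, & d_1=5\end{cases}$$ and $$\operatorname{pd}\frac{S}{NI(G_1^2)}=\begin{cases} 2p_1+2, & d_1=0\\ 2p_1+3, & d_1\in\{1,2,3\}\\ 2p_1+4, & d_1\in\{4,5\}.\end{cases}$$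
   Context: $K$ is a field. For $n,m,s\ge 2$, the double broom graph $G_1=B(n,m,s)$ is the simple graph with vertex set $V(G_1)=\{x_1,\ldots,x_n,y_1,\ldots,y_m,z_1,\ldots,z_s\}$ and edge set $E(G_1)=\{\{x_i,y_1\}:1\le i\le n\}\cup\{\{y_j,y_{j+1}\}:1\le j\le m-1\}\cup\{\{y_m,z_r\}:1\le r\le s\}$. Its square $G_1^2$ is the graph on the same vertex set with edge set $E(G_1^2)=E(G_1)\cup\{\{x_i,x_j\}:1\le i<j\le n\}\cup\{\{x_i,y_2\}:1\le i\le n\}\cup\{\{y_j,y_{j+2}\}:1\le j\le m-2\}\cup\{\{y_{m-1},z_r\}:1\le r\le s\}\cup\{\{z_r,z_h\}:1\le r<h\le s\}$. For a simple graph $H$ and a vertex $u$, the closed neighborhood is $N[u]=\{u\}\cup\{v:\{u,v\}\in E(H)\}$. The closed neighborhood ideal $NI(H)$ is the squarefree monomial ideal of the polynomial ring $K[V(H)]$ (whose variables are the vertices) generated by the monomials $\prod_{v\in N[u]}v$, for $u\in V(H)$. The ring $S$ is standard graded. For a homogeneous ideal $I\subset S$ with graded Betti numbers $\beta_{ij}$ of the minimal graded free resolution of $S/I$, $\operatorname{pd}(S/I)=\max\{i:\beta_{ij}\ne0\}$ and $\operatorname{reg}(S/I)=\max\{j-i:\beta_{ij}\neq 0\}$ (Castelnuovo--Mumford regularity). *)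

(* Defs.v *)
From HB Require Import structures.
From mathcomp Require Import all_boot all_order all_algebra.
From mathcomp Require Import mpoly zify.

Set Implicit Arguments.
Unset Strict Implicit.
Unset Printing Implicit Defensive.

Import Order.TTheory GRing.Theory Num.Theory.
Local Open Scope ring_scope.

(** * Minimal graded free resolutions of [S/I], [S = K[X_0, .., X_(N-1)]] *)

(* The free module in homological degree [i] is the direct sum over
   [k : 'I_(rk i)] of [S(- shift k)].  Its elements are row vectors, and
   matrices act on the right: [diff i] maps degree [i.+1] to degree [i].
   [aug] lifts the augmentation map onto [S/I] to a map into [S]. *)
Record free_complex (K : fieldType) (N : nat) := FreeComplex {
  rk : nat -> nat;
  shift : forall i : nat, 'I_(rk i) -> int;
  diff : forall i : nat, 'M[{mpoly K[N]}]_(rk i.+1, rk i);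
  aug : 'cV[{mpoly K[N]}]_(rk 0)
}.

(* Multiplication by [p] is a degree-0 map [S(-a) -> S(-b)]. *)
Definition graded_entry (K : fieldType) (N : nat)
    (a b : int) (p : {mpoly K[N]}) : Prop :=
  p = 0 \/ exists2 d : nat, p \is d.-homog & a = b + d%:Z.

Definition graded_complex (K : fieldType) (N : nat)
    (F : free_complex K N) : Prop :=
  (forall i k l, graded_entry (shift (i := i.+1) k) (shift (i := i) l)
                   (diff F i k l))
  /\ (forall k, graded_entry (shift (i := 0%N) k) 0 (aug F k ord0)).

Definition resolves (K : fieldType) (N : nat)
    (I : {mpoly K[N]} -> Prop) (F : free_complex K N) : Prop :=
  [/\ forall f : {mpoly K[N]},
        exists v : 'rV_(rk F 0), I (f - (v *m aug F) ord0 ord0),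
      forall v : 'rV_(rk F 0),
        I ((v *m aug F) ord0 ord0) <->
        exists w : 'rV_(rk F 1), v = w *m diff F 0
    & forall (i : nat) (v : 'rV_(rk F i.+1)),
        v *m diff F i = 0 <->
        exists w : 'rV_(rk F i.+2), v = w *m diff F i.+1].

(* The image of each differential lies in [(X_0, .., X_(N-1))] times its
   target. *)
Definition minimal_complex (K : fieldType) (N : nat)
    (F : free_complex K N) : Prop :=
  forall i k l, (diff F i k l)@_0%MM = 0.

Definition minimal_graded_free_resolution (K : fieldType) (N : nat)
    (I : {mpoly K[N]} -> Prop) (F : free_complex K N) : Prop :=
  [/\ graded_complex F, resolves I F & minimal_complex F].

Definition betti (K : fieldType) (N : nat)
    (F : free_complex K N) (i : nat) (j : int) : nat :=
  #|[set k : 'I_(rk F i) | shift k == j]|.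

Definition is_max (d : Order.disp_t) (T : porderType d)
    (P : T -> Prop) (x : T) : Prop :=
  P x /\ forall y : T, P y -> (y <= x)%O.

(* [pd (S/I) = p] and [reg (S/I) = r].  Since the minimal graded free
   resolution is unique only up to isomorphism, the value is required to be
   the same for all of them, and one is required to exist. *)
Definition has_pd (K : fieldType) (N : nat)
    (I : {mpoly K[N]} -> Prop) (p : nat) : Prop :=
  (exists F, minimal_graded_free_resolution I F) /\
  forall F, minimal_graded_free_resolution I F ->
    is_max (fun i : nat => exists j : int, betti F i j <> 0%N) p.

Definition has_reg (K : fieldType) (N : nat)
    (I : {mpoly K[N]} -> Prop) (r : int) : Prop :=
  (exists F, minimal_graded_free_resolution I F) /\
  forall F, minimal_graded_free_resolution I F ->
    is_max (fun c : int => exists (i : nat) (j : int),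
              betti F i j <> 0%N /\ c = j - i%:Z) r.

(** * Closed neighborhood ideals *)

Definition ideal_gen (R : comNzRingType) (T : finType) (g : T -> R)
    (f : R) : Prop :=
  exists c : T -> R, f = \sum_(t : T) c t * g t.

Definition closed_nbhd (V : finType) (e : rel V) (u : V) : {set V} :=
  [set v | (v == u) || e u v].

(* The variable attached to the vertex [v] is ['X_(enum_rank v)]. *)
Definition NI (K : fieldType) (V : finType) (e : rel V) :
    {mpoly K[#|V|]} -> Prop :=
  ideal_gen (fun u : V => \prod_(v in closed_nbhd e u) 'X_(enum_rank v)).

Arguments NI K {V} e _.

(** * The double broom graph and its square *)

(* [inl (inl i)], [inl (inr j)] and [inr r] stand for the vertices
   x_(i+1), y_(j+1) and z_(r+1). *)
Definition broom_vertex (n m s : nat) : finType := ('I_n + 'I_m + 'I_s)%type.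

Definition broom_edge (n m s : nat) : rel (broom_vertex n m s) :=
  fun u v => match u, v with
  | inl (inl _), inl (inr j) => j == 0%N :> nat
  | inl (inr j), inl (inr k) => k == j.+1 :> nat
  | inl (inr j), inr _ => j.+1 == m
  | _, _ => false
  end.

Definition double_broom (n m s : nat) : rel (broom_vertex n m s) :=
  fun u v => broom_edge u v || broom_edge v u.

Definition broom_sq_edge (n m s : nat) : rel (broom_vertex n m s) :=
  fun u v => broom_edge u v || match u, v with
  | inl (inl i), inl (inl j) => (i < j)%N
  | inl (inl _), inl (inr j) => j == 1%N :> nat
  | inl (inr j), inl (inr k) => k == j.+2 :> nat
  | inl (inr j), inr _ => j.+2 == m
  | inr r, inr h => (r < h)%N
  | _, _ => false
  end.

Definition double_broom_sq (n m s : nat) : rel (broom_vertex n m s) :=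
  fun u v => broom_sq_edge u v || broom_sq_edge v u.

(* [double_broom_sq] is the square of [double_broom]: its edges join the
   distinct vertices at distance at most 2. *)
Lemma double_broom_sqE (n m s : nat) (u v : broom_vertex n m s) :
  (2 <= m)%N ->
  double_broom_sq u v =
  (u != v) && (double_broom u v ||
               [exists w, double_broom u w && double_broom w v]).
Proof.
move=> m2.
pose y j (h : (j < m)%N) : broom_vertex n m s := inl (inr (Ordinal h)).
have neqE (a b : broom_vertex n m s) : (a != b) =
    match a, b with
    | inl (inl i), inl (inl j) => i != j :> nat
    | inl (inr i), inl (inr j) => i != j :> nat
    | inr i, inr j => i != j :> nat
    | _, _ => true end.
  by case: a b => [[a|a]|a] [[b|b]|b].
rewrite neqE; apply/idP/andP => [H|[]].
- split.
    by move: H; case: u v => [[u|u]|u] [[v|v]|v];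
      rewrite /double_broom_sq /broom_sq_edge //=; lia.
  have m1 : (m - 1 < m)%N by lia.
  have mid w : double_broom u w && double_broom w v ->
      double_broom u v || [exists w, double_broom u w && double_broom w v].
    by move=> Hw; apply/orP; right; apply/existsP; exists w.
  case: (boolP (double_broom u v)) => // nuv.
  rewrite (negbTE nuv) /= in mid; apply: contraTT H => Hn0.
  have Hn w : ~~ (double_broom u w && double_broom w v).
    by apply: contra Hn0 => /mid.
  have h0 := Hn (y _ (ltnW m2)); have h1 := Hn (y _ m1).
  move: nuv h0 h1 Hn {mid Hn0}.
  rewrite /double_broom_sq /double_broom /y.
  case: u v => [[u|u]|u] [[v|v]|v];
    have := ltn_ord u; have := ltn_ord v => hv hu; rewrite /=;
    try (by rewrite /broom_sq_edge /=; move=> h2 h0 h1 _; lia).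
  rewrite /broom_sq_edge /= => nuv _ _ Hn; apply/negP => H.
  have hw : (minn u v + 1 < m)%N by lia.
  by move: (Hn (y _ hw)); rewrite /y /=; lia.
- move=> huv /orP[|/existsP[w]].
    by rewrite /double_broom_sq /double_broom /broom_sq_edge; lia.
  move: huv; case: u v w => [[u|u]|u] [[v|v]|v] [[w|w]|w];
    have := ltn_ord u; have := ltn_ord v; have := ltn_ord w => hw hv hu;
    rewrite /double_broom_sq /double_broom /broom_sq_edge /=; lia.
Qed.

Arguments double_broom_sq n m s _ _ : clear implicits.

(* Main.v *)
Require Import Defs.
From mathcomp Require Import all_boot all_order all_algebra.
From mathcomp Require Import mpoly zify ring.
From Stdlib Require Import IndefiniteDescription.

(** Collapse the vertices of the broom to blocks: block [0] consists of all the
    [x_i], block [j] of [y_j] alone for [1 <= j <= m], and block [m + 1] of all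
    the [z_r].  Two vertices are equal or adjacent in the square exactly when
    their blocks are at distance at most 2, so every closed neighborhood is a
    window of consecutive blocks, and the minimal ones are the blocks [0..2],
    the blocks [j..j+4] for [1 <= j <= m - 4], and the blocks [m-1..m+1].

    The windows are added one at a time, from left to right.  For an ideal [I]
    and a monomial [v] there is an exact sequence
    [0 -> S/(I : v)(- deg v) -> S/I -> S/(I + (v)) -> 0], so that the mapping
    cone of a lift of multiplication by [v] resolves [S/(I + (v))].  The last
    block of the new window does not occur in the old ones.  Writing [v = u * w]
    with [w] the monomial of that block, one has [I : v = I : u], and [w] times
    a lift of multiplication by [u] is a lift of multiplication by [v] with all
    its entries in the maximal ideal.  The cone is therefore minimal
    ([adjoin_resolution]), and
    [pd (S/(I + (v))) = max (pd (S/I)) (pd (S/(I : v)) + 1)],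
    [reg (S/(I + (v))) = max (reg (S/I)) (reg (S/(I : v)) + deg v - 1)].

    The colon ideals that occur are again generated by windows.
    - Adding an inner window [j..j+4] gives block [j - 1] together with the
      inner windows that end before it; that block is regular modulo those
      windows, so six steps back the same family reappears, with the projective
      dimension raised by 2 and the regularity by 4 ([inner_pd_reg]).
    - Adding the final window [k..k+2] gives the same configuration with final
      window [k-3..k-1] ([end_pd_reg_step]).  Hence three steps raise the
      projective dimension by 1 and the regularity by 2, which at least matches
      the contribution of the inner windows ([end_pd_reg]).
    Only the last of these steps sees the block of the [z_r], which replaces
    the degree 3 of a final window by [s + 2].

    That the result is independent of the resolution is the usual comparison
    argument: chain maps lifting the identity in both directions compose to the
    identity modulo the maximal ideal ([betti_support_sub]). *)

Set Implicit Arguments.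
Unset Strict Implicit.
Unset Printing Implicit Defensive.

Import Order.TTheory GRing.Theory Num.Theory.
Local Open Scope ring_scope.

(** * Homogeneous components and graded matrices *)

Section GradedMatrices.
Variables (K : fieldType) (N : nat).
Local Notation R := {mpoly K[N]}.
Implicit Types (p q : R) (a b c e : int).

Definition gcomp e p : R :=
  if e is Posz d then pihomog mdeg d p else 0.

Lemma mcoeff_gcomp e p m :
  (gcomp e p)@_m = if (mdeg m)%:Z == e then p@_m else 0.
Proof.
case: e => [d|d]; last by rewrite mcoeff0.
rewrite /gcomp pihomogE raddf_sum /= eqz_nat.
have [mp|mp] := boolP (m \in msupp p); last first.
  rewrite memN_msupp_eq0 // if_same big_seq_cond big1 // => m' /andP[m'p _].
  rewrite mcoeffZ mcoeffX; case: eqVneq => [mm|]; last by rewrite mulr0.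
  by rewrite -mm m'p in mp.
rewrite big_mkcond (bigD1_seq m) //= big1 ?addr0 => [|m' m'm].
  by case: ifP => //; rewrite mcoeffZ mcoeffX eqxx mulr1.
by case: ifP => // _; rewrite mcoeffZ mcoeffX (negPf m'm) mulr0.
Qed.

Lemma gcompB e p q : gcomp e (p - q) = gcomp e p - gcomp e q.
Proof.
by apply/mpolyP => m; rewrite mcoeffB !mcoeff_gcomp mcoeffB;
  case: ifP; rewrite ?subr0.
Qed.

Lemma gcomp0 e : gcomp e 0 = 0.
Proof. by apply/mpolyP => m; rewrite !mcoeff_gcomp !mcoeff0 if_same. Qed.

Lemma gcompD e : {morph gcomp e : p q / p + q}.
Proof.
by move=> p q; apply/mpolyP => m;
  rewrite mcoeffD !mcoeff_gcomp mcoeffD; case: ifP; rewrite ?addr0.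
Qed.

Lemma gcomp_sum e (T : Type) (r : seq T) (F : T -> R) :
  gcomp e (\sum_(t <- r) F t) = \sum_(t <- r) gcomp e (F t).
Proof. exact: (big_morph _ (gcompD e) (gcomp0 e)). Qed.

Lemma graded_entryP a b p :
  graded_entry a b p <-> (forall m, m \in msupp p -> (mdeg m)%:Z = a - b).
Proof.
split=> [[->|[d /dhomogP hp ->]] m|H]; first by rewrite msupp0.
  by move=> /hp ->; lia.
have [->|p0] := eqVneq p 0; first by left.
right; have /mlead_supp/H E := p0.
exists (mdeg (mlead p)); last by rewrite E addrC subrK.
by apply/dhomogP => m /H Hm; apply/eqP; rewrite -eqz_nat Hm E.
Qed.

Lemma gcomp_id a b p : graded_entry a b p -> gcomp (a - b) p = p.
Proof.
move/graded_entryP=> H; apply/mpolyP => m; rewrite mcoeff_gcomp.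
case: eqP => // neq; rewrite memN_msupp_eq0 //.
by apply/negP => /H.
Qed.

Lemma graded_gcomp a b p : graded_entry a b (gcomp (a - b) p).
Proof.
apply/graded_entryP => m; rewrite mcoeff_msupp mcoeff_gcomp.
by case: ifP => [/eqP|]; rewrite ?eqxx.
Qed.

(** A homogeneous factor shifts all degrees by the same amount, so taking
    components commutes with multiplication by it. *)
Lemma gcompM a b c p q : graded_entry b c q ->
  gcomp (a - c) (p * q) = gcomp (a - b) p * q.
Proof.
move=> /graded_entryP hq; apply/mpolyP => m; rewrite mcoeff_gcomp !mcoeffM.
case: ifP => mac; last first.
  rewrite big1 // => -[[k1 ?] [k2 ?]] /eqP /(congr1 mdeg).
  rewrite mdegD /= => E; rewrite mcoeff_gcomp.
  case: eqP => [k1ab|]; last by rewrite mul0r.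
  have [/hq k2bc|/memN_msupp_eq0->] := boolP (k2 \in msupp q);
    last by rewrite mulr0.
  by case/eqP: mac; lia.
apply: eq_bigr => -[[k1 ?] [k2 ?]] /eqP /(congr1 mdeg).
rewrite mdegD /= => E; rewrite mcoeff_gcomp.
have [/hq k2bc|/memN_msupp_eq0->] := boolP (k2 \in msupp q);
  last by rewrite !mulr0.
case: eqP => // k1ab.
by case: k1ab; move/eqP: mac; lia.
Qed.

Definition graded_mx r s (sr : 'I_r -> int) (ss : 'I_s -> int)
    (A : 'M[R]_(r, s)) : Prop :=
  forall k l, graded_entry (sr k) (ss l) (A k l).

(** The degree-preserving part of a map between the graded free modules with
    generators in degrees [sr] and [ss]. *)
Definition gproj r s (sr : 'I_r -> int) (ss : 'I_s -> int)
    (A : 'M[R]_(r, s)) : 'M[R]_(r, s) :=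
  \matrix_(k, l) gcomp (sr k - ss l) (A k l).

Lemma graded_gproj r s sr ss (A : 'M[R]_(r, s)) :
  graded_mx sr ss (gproj sr ss A).
Proof. by move=> k l; rewrite mxE; apply: graded_gcomp. Qed.

Lemma graded_mxE r s sr ss (A : 'M[R]_(r, s)) :
  graded_mx sr ss A <-> gproj sr ss A = A.
Proof.
split=> [gA|<-]; last exact: graded_gproj.
by apply/matrixP => k l; rewrite mxE gcomp_id.
Qed.

(** Any solution [A] of [A *m B = C] with [B] and [C] graded can thus be
    replaced by its degree-preserving part; all graded lifts are obtained in
    this way. *)
Lemma gprojM r s t sr ss st (A : 'M[R]_(r, s)) (B : 'M[R]_(s, t)) :
  graded_mx ss st B -> gproj sr st (A *m B) = gproj sr ss A *m B.
Proof.
move=> gB; apply/matrixP => k l; rewrite !mxE gcomp_sum.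
by apply: eq_bigr => i _; rewrite mxE (gcompM _ _ (gB _ _)).
Qed.

Lemma graded_mulmx r s t sr ss st (A : 'M[R]_(r, s)) (B : 'M[R]_(s, t)) :
  graded_mx sr ss A -> graded_mx ss st B -> graded_mx sr st (A *m B).
Proof.
by move=> /graded_mxE gA gB; apply/graded_mxE; rewrite (gprojM _ _ gB) gA.
Qed.

Lemma graded_oppmx r s sr ss (A : 'M[R]_(r, s)) :
  graded_mx sr ss A -> graded_mx sr ss (- A).
Proof.
move=> gA k l; rewrite mxE; apply/graded_entryP => m.
by rewrite (perm_mem (msuppN _)); apply/graded_entryP: m.
Qed.

Lemma graded_shift r s sr ss (A : 'M[R]_(r, s)) c :
  graded_mx sr ss A -> graded_mx (fun k => sr k + c) (fun l => ss l + c) A.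
Proof.
move=> gA k l; apply/graded_entryP => m /(proj1 (graded_entryP _ _ _) (gA k l)) ->.
by lia.
Qed.

Lemma graded_scalemx r s sr ss (A : 'M[R]_(r, s)) (d : nat) p :
  p \is d.-homog -> graded_mx sr ss A ->
  graded_mx (fun k => sr k + d%:Z) ss (p *: A).
Proof.
move=> hp gA k l; rewrite mxE; have [->|[e hA ->]] := gA k l.
  by left; rewrite mulr0.
by right; exists (d + e)%N; [apply: dhomogM | lia].
Qed.

(** Vanishing modulo the ideal generated by the variables: the condition that
    minimality puts on differentials. *)
Definition radical_mx r s (A : 'M[R]_(r, s)) : Prop :=
  forall k l, (A k l)@_0%MM = 0.

Lemma radical_mulmxl r s t (A : 'M[R]_(r, s)) (B : 'M[R]_(s, t)) :
  radical_mx A -> radical_mx (A *m B).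
Proof.
move=> rA k l; rewrite mxE raddf_sum /= big1 // => i _.
by rewrite (rmorphM (mcoeff 0%MM)) /= rA mul0r.
Qed.

Lemma radical_mulmxr r s t (A : 'M[R]_(r, s)) (B : 'M[R]_(s, t)) :
  radical_mx B -> radical_mx (A *m B).
Proof.
move=> rB k l; rewrite mxE raddf_sum /= big1 // => i _.
by rewrite (rmorphM (mcoeff 0%MM)) /= rB mulr0.
Qed.

Lemma radical_scalemx r s (A : 'M[R]_(r, s)) p :
  p@_0%MM = 0 -> radical_mx (p *: A).
Proof. by move=> p0 k l; rewrite mxE (rmorphM (mcoeff 0%MM)) /= p0 mul0r. Qed.

End GradedMatrices.

(** * Comparison of graded free resolutions *)

Section FreeResolutions.
Variables (K : fieldType) (N : nat).
Local Notation R := {mpoly K[N]}.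
Local Notation sh F i := (@shift K N F i).
Implicit Types (F G H : free_complex K N) (I J : R -> Prop).

Record homogeneous_ideal I : Prop := HomogeneousIdeal {
  ideal0 : I 0;
  idealD : forall p q, I p -> I q -> I (p + q);
  idealM : forall p q, I q -> I (p * q);
  ideal_gcomp : forall e p, I p -> I (gcomp e p)
}.

Lemma homogeneous_ideal_ext I J :
  (forall f, I f <-> J f) -> homogeneous_ideal I -> homogeneous_ideal J.
Proof.
move=> IJ [I0 ID IM Ig]; split=> [|p q|p q|e p]; rewrite -!IJ //.
- exact: ID.
- exact: IM.
- exact: Ig.
Qed.

Lemma idealN I p : homogeneous_ideal I -> I p -> I (- p).
Proof. by move=> hI Ip; rewrite -mulN1r; apply: idealM. Qed.

Lemma idealB I p q : homogeneous_ideal I -> I p -> I q -> I (p - q).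
Proof. by move=> hI Ip Iq; apply: idealD => //; apply: idealN. Qed.

Lemma mxBE r s (A B : 'M[R]_(r, s)) k l : (A - B) k l = A k l - B k l.
Proof. by rewrite !mxE. Qed.

Lemma ideal_mulmx I r s (A : 'M[R]_(r, s)) (v : 'cV[R]_s) :
  homogeneous_ideal I -> (forall k, I (v k ord0)) ->
  forall k, I ((A *m v) k ord0).
Proof.
move=> hI Iv k; rewrite mxE.
elim/big_ind: _ => [|p q Ip Iq|i _]; first exact: ideal0.
  exact: idealD.
exact: idealM.
Qed.

(** The degree of the generator of [S], the target of the augmentation. *)
Definition aug_shift (k : 'I_1) : int := 0.

Section Lifting.
Variables (I : R -> Prop) (F : free_complex K N).
Hypotheses (hI : homogeneous_ideal I).
Hypotheses (gF : graded_complex F) (rF : resolves I F).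

Lemma graded_diff i : graded_mx (sh F i.+1) (sh F i) (diff F i).
Proof. exact: (proj1 gF). Qed.

Lemma graded_aug : graded_mx (sh F 0) aug_shift (aug F).
Proof. by move=> k l; rewrite ord1; apply: (proj2 gF). Qed.

Lemma diff_diff i : diff F i.+1 *m diff F i = 0.
Proof.
case: rF => _ _ ex; apply/row_matrixP => k; rewrite row_mul row0.
by apply/ex; exists (delta_mx ord0 k); rewrite rowE.
Qed.

Lemma diff_aug k : I ((diff F 0 *m aug F) k ord0).
Proof.
case: rF => _ ex _; have := proj2 (ex (row k (diff F 0))).
rewrite -row_mul [row _ _ _ _]mxE; apply.
by exists (delta_mx ord0 k); rewrite rowE.
Qed.

Lemma lift_diff r (sr : 'I_r -> int) i (v : 'M[R]_(r, rk F i.+1)) :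
  graded_mx sr (sh F i.+1) v -> v *m diff F i = 0 ->
  exists2 w : 'M[R]_(r, rk F i.+2),
    graded_mx sr (sh F i.+2) w & v = w *m diff F i.+1.
Proof.
move=> /graded_mxE gv v0.
have /fin_all_exists [w vw] k :
    exists w : 'rV_(rk F i.+2), row k v = w *m diff F i.+1.
  by case: rF => _ _ ex; apply/ex; rewrite -row_mul v0 row0.
exists (gproj sr (sh F i.+2) (\matrix_k w k)); first exact: graded_gproj.
rewrite -(gprojM _ _ (@graded_diff i.+1)) -[LHS]gv; congr (gproj _ _ _).
by apply/row_matrixP => k; rewrite row_mul rowK.
Qed.

Lemma lift_syzygy r (sr : 'I_r -> int) (v : 'M[R]_(r, rk F 0)) :
  graded_mx sr (sh F 0) v -> (forall k, I ((v *m aug F) k ord0)) ->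
  exists2 w : 'M[R]_(r, rk F 1),
    graded_mx sr (sh F 1) w & v = w *m diff F 0.
Proof.
move=> /graded_mxE gv v0.
have /fin_all_exists [w vw] k :
    exists w : 'rV_(rk F 1), row k v = w *m diff F 0.
  by case: rF => _ ex _; apply/ex; rewrite -row_mul [row _ _ _ _]mxE.
exists (gproj sr (sh F 1) (\matrix_k w k)); first exact: graded_gproj.
rewrite -(gprojM _ _ (@graded_diff 0)) -[LHS]gv; congr (gproj _ _ _).
by apply/row_matrixP => k; rewrite row_mul rowK.
Qed.

Lemma lift_aug r (sr : 'I_r -> int) (a : 'cV[R]_r) :
  graded_mx sr aug_shift a ->
  exists2 phi : 'M[R]_(r, rk F 0),
    graded_mx sr (sh F 0) phi & forall k, I ((a - phi *m aug F) k ord0).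
Proof.
move=> ga.
have /fin_all_exists [w aw] k :
    exists w : 'rV_(rk F 0), I (a k ord0 - (w *m aug F) ord0 ord0).
  by case: rF => + _ _; apply.
exists (gproj sr (sh F 0) (\matrix_k w k)); first exact: graded_gproj.
move=> k; move/graded_mxE: ga => <-.
rewrite -(gprojM _ _ graded_aug) mxBE [X in X - _]mxE [X in _ - X]mxE -gcompB.
apply: (ideal_gcomp hI).
by have := aw k; rewrite -[w k](rowK w) -row_mul [row _ _ _ _]mxE.
Qed.

End Lifting.

Definition chain_map F G (phi : forall i, 'M[R]_(rk F i, rk G i)) : Prop :=
  forall i, diff F i *m phi i = phi i.+1 *m diff G i.

(** Multiplication by [u] maps [S/J] to [S/I] and raises degrees by [d]; it
    lifts to the resolutions because the source is free and the target exact. *)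
Lemma comparison I J F G (u : R) (d : nat) :
  homogeneous_ideal I ->
  graded_complex F -> resolves J F -> graded_complex G -> resolves I G ->
  u \is d.-homog -> (forall p, J p -> I (u * p)) ->
  exists phi : forall i, 'M[R]_(rk F i, rk G i),
    [/\ forall i, graded_mx (fun k => sh F i k + d%:Z) (sh G i) (phi i),
        forall k, I ((u *: aug F - phi 0%N *m aug G) k ord0)
      & chain_map phi].
Proof.
move=> hI gF rF gG rG hu JI.
pose sd i k : int := sh F i k + d%:Z.
(* A lift in homological degree [i] is kept together with the existence of a
   lift in degree [i + 1], so that the latter can be chosen at the next stage. *)
pose good i (phi : 'M[R]_(rk F i, rk G i)) :=
  graded_mx (sd i) (sh G i) phi /\
  exists2 psi : 'M[R]_(rk F i.+1, rk G i.+1),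
    graded_mx (sd i.+1) (sh G i.+1) psi & diff F i *m phi = psi *m diff G i.
have [phi0 gphi0 aphi0] := lift_aug hI gG rG (graded_scalemx hu (graded_aug gF)).
have good0 : good 0%N phi0.
  split=> //; apply: (lift_syzygy gG rG) => [|k].
    exact: graded_mulmx (graded_shift d%:Z (graded_diff gF (i := 0))) gphi0.
  rewrite -mulmxA -[_ *m aug G](subKr (u *: aug F)) mulmxBr mxBE.
  apply: (idealB hI); last exact: (ideal_mulmx _ hI).
  by rewrite -scalemxAr mxE; apply/JI/(diff_aug rF).
have step i (phi : {phi | good i phi}) :
    exists psi : {psi | good i.+1 psi},
      diff F i *m sval phi = sval psi *m diff G i.
  case: phi => phi [gphi [psi gpsi comm]].
  suff gd : good i.+1 psi by exists (exist _ psi gd).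
  split=> //; apply: (lift_diff gG rG).
    exact: graded_mulmx (graded_shift d%:Z (graded_diff gF (i := i.+1))) gpsi.
  by rewrite -mulmxA -comm mulmxA (diff_diff rF) mul0mx.
pose next i phi := proj1_sig (constructive_indefinite_description _ (step i phi)).
pose fix phi i : {phi | good i phi} :=
  if i is i'.+1 then next i' (phi i') else exist _ phi0 good0.
exists (fun i => sval (phi i)); split=> //.
  by move=> i; case: (svalP (phi i)).
move=> i /=; rewrite /next.
by case: (constructive_indefinite_description _ _).
Qed.

(** A lift of the zero map of [S/I] is null-homotopic, of the form
    [d h + h d], and both summands vanish modulo the variables when [d] does.
    The induction carries a single component of the homotopy: the equation kept
    with it is what exactness needs to produce the next one. *)
Lemma null_homotopic_radical I F (theta : forall i, 'M[R]_(rk F i, rk F i)) :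
  resolves I F -> minimal_complex F -> chain_map theta ->
  (forall k, I ((theta 0%N *m aug F) k ord0)) ->
  forall i, radical_mx (theta i).
Proof.
move=> rF mF cth th0 i.
suff [] : radical_mx (theta i) /\ exists h : 'M_(rk F i, rk F i.+1),
    diff F i *m (theta i - h *m diff F i) = 0 by [].
elim: i => [|i [_ [h dh]]].
  have /fin_all_exists [h th] k :
      exists w : 'rV_(rk F 1), row k (theta 0%N) = w *m diff F 0.
    by case: rF => _ ex _; apply/ex; rewrite -row_mul [row _ _ _ _]mxE.
  have E : theta 0%N = (\matrix_k h k) *m diff F 0.
    by apply/row_matrixP => k; rewrite row_mul rowK.
  split; first by rewrite E; apply: radical_mulmxr; apply: mF.
  by exists (\matrix_k h k); rewrite -E subrr mulmx0.
have th1 : (theta i.+1 - diff F i *m h) *m diff F i = 0.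
  by rewrite mulmxBl -cth -mulmxA -mulmxBr.
have /fin_all_exists [h' th] k : exists w : 'rV_(rk F i.+2),
    row k (theta i.+1 - diff F i *m h) = w *m diff F i.+1.
  by case: rF => _ _ ex; apply/ex; rewrite -row_mul th1 row0.
have E : theta i.+1 - diff F i *m h = (\matrix_k h' k) *m diff F i.+1.
  by apply/row_matrixP => k; rewrite row_mul rowK.
split; last first.
  exists (\matrix_k h' k).
  by rewrite -E subKr mulmxA (diff_diff rF) mul0mx.
rewrite -[theta _](subrK (diff F i *m h)) E => k l.
rewrite mxE mcoeffD radical_mulmxr ?add0r; last exact: mF.
by rewrite radical_mulmxl //; apply: mF.
Qed.

Definition betti_support F i j : Prop := exists k, sh F i k = j.

Lemma bettiP F i j : betti F i j <> 0%N <-> betti_support F i j.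
Proof.
split=> [/eqP|[k E]].
  by rewrite -lt0n => /card_gt0P[k]; rewrite inE => /eqP; exists k.
by apply/eqP; rewrite -lt0n; apply/card_gt0P; exists k; rewrite inE; apply/eqP.
Qed.

(** Lifts of the identity in both directions compose to a map which is the
    identity modulo the variables.  Hence each generator of [F] is mapped with a
    nonzero constant coefficient to some generator of [G], and a constant entry
    of a graded matrix joins generators of the same degree. *)
Lemma betti_support_sub I F G i j : homogeneous_ideal I ->
  minimal_graded_free_resolution I F -> minimal_graded_free_resolution I G ->
  betti_support F i j -> betti_support G i j.
Proof.
move=> hI [gF rF mF] [gG rG _] [k shk].
have h1 : (1 : R) \is 0.-homog by exact: dhomog1.
have I1 p : I p -> I (1 * p) by rewrite mul1r.
have [phi [gphi aphi cphi]] := comparison hI gF rF gG rG h1 I1.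
have [psi [_ apsi cpsi]] := comparison hI gG rG gF rF h1 I1.
pose theta i := 1%:M - phi i *m psi i.
have cth : chain_map theta.
  move=> e; rewrite /theta mulmxBl mulmxBr mulmx1 mul1mx.
  by rewrite mulmxA cphi -!mulmxA cpsi.
have th0 l : I ((theta 0%N *m aug F) l ord0).
  have -> : theta 0%N *m aug F = (1 *: aug F - phi 0%N *m aug G)
     + phi 0%N *m (1 *: aug G - psi 0%N *m aug F).
    by rewrite mulmxBl mul1mx !scale1r mulmxBr addrA subrK mulmxA.
  by rewrite mxE; apply: (idealD hI) => //; apply: (ideal_mulmx _ hI).
have := null_homotopic_radical rF mF cth th0 (i := i) k k.
rewrite !mxE eqxx mcoeffB mcoeff1 eqxx raddf_sum /= => /eqP.
rewrite subr_eq0 => /eqP E.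
have [l nz] : exists l, (phi i k l)@_0%MM != 0.
  apply/existsP; apply: contraT => /existsPn z.
  have /eqP := E; rewrite big1 ?oner_eq0 // => l _.
  by have /negPn/eqP z0 := z l; rewrite (rmorphM (mcoeff 0%MM)) /= z0 mul0r.
exists l; rewrite -shk.
have /graded_entryP/(_ 0%MM) := gphi i k l.
by rewrite mcoeff_msupp nz mdeg0 => /(_ isT); lia.
Qed.

End FreeResolutions.

(** * The mapping cone of a multiplication map *)

Section MappingCone.
Variables (K : fieldType) (N : nat).
Local Notation R := {mpoly K[N]}.
Local Notation sh F i := (@shift K N F i).

Section Cone.
Variables (F G : free_complex K N) (d : nat).
Variable phi : forall i, 'M[R]_(rk G i, rk F i).

(** The mapping cone of [phi], from [G] shifted by [d] to [F].  The
    augmentation is that of [F], since the new generators start in homological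
    degree 1. *)
Definition cone_rk (i : nat) : nat :=
  if i is i'.+1 then (rk F i'.+1 + rk G i')%N else rk F 0.

Definition cone_shift (i : nat) : 'I_(cone_rk i) -> int :=
  match i with
  | 0 => sh F 0
  | i'.+1 => fun k =>
      match split k with inl a => sh F i'.+1 a | inr b => sh G i' b + d%:Z end
  end.

Definition cone_diff (i : nat) : 'M[R]_(cone_rk i.+1, cone_rk i) :=
  match i with
  | 0 => col_mx (diff F 0) (phi 0%N)
  | i'.+1 => block_mx (diff F i'.+1) 0 (phi i'.+1) (- diff G i')
  end.

Definition cone : free_complex K N :=
  @FreeComplex K N cone_rk cone_shift cone_diff (aug F).

Lemma betti_support_cone i j :
  betti_support cone i j <->
  betti_support F i j \/ exists2 i', i = i'.+1 & betti_support G i' (j - d%:Z).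
Proof.
split.
  case: i => [|i] [k /=]; first by move=> E; left; exists k.
  rewrite /cone_shift; case: (split k) => [a|b] E; first by left; exists a.
  by right; exists i => //; exists b; rewrite -E addrK.
case=> [[k E]|[i' -> [k E]]].
  case: i k E => [|i] k E; first by exists k.
  by exists (lshift _ k); rewrite /= /cone_shift (unsplitK (inl k)).
exists (rshift _ k); rewrite /= /cone_shift (unsplitK (inr k)) E.
by rewrite subrK.
Qed.

Lemma graded_cone : graded_complex F -> graded_complex G ->
  (forall i, graded_mx (fun k => sh G i k + d%:Z) (sh F i) (phi i)) ->
  graded_complex cone.
Proof.
move=> gF gG gphi; split; last exact: (proj2 gF).
case=> [|i] k l /=; rewrite ?/cone_shift /cone_diff.
  rewrite -[k]splitK; case: (split k) => a; rewrite unsplitK ?col_mxEu ?col_mxEd.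
    exact: (proj1 gF).
  exact: gphi.
rewrite -[k]splitK -[l]splitK.
case: (split k) => a; case: (split l) => b; rewrite !unsplitK.
- by rewrite block_mxEul; apply: (proj1 gF).
- by rewrite block_mxEur mxE; left.
- by rewrite block_mxEdl; apply: gphi.
- rewrite block_mxEdr.
  exact: (graded_oppmx (graded_shift d%:Z (graded_diff gG (i := i)))).
Qed.

Lemma minimal_cone : minimal_complex F -> minimal_complex G ->
  (forall i, radical_mx (phi i)) -> minimal_complex cone.
Proof.
move=> mF mG mphi [|i] k l /=.
  rewrite -[k]splitK; case: (split k) => a;
    rewrite ?col_mxEu ?col_mxEd; [exact: mF | exact: mphi].
rewrite -[k]splitK -[l]splitK; case: (split k) => a; case: (split l) => b.
- by rewrite block_mxEul; apply: mF.
- by rewrite block_mxEur mxE mcoeff0.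
- by rewrite block_mxEdl; apply: mphi.
- by rewrite block_mxEdr mxE mcoeffN mG oppr0.
Qed.

Definition adjoin (I : R -> Prop) (u f : R) : Prop := exists c, I (f - c * u).

(** The long exact sequence of the cone, written out on rows: multiplication
    by [u] from [S/J] to [S/I] is injective because [J] is the colon ideal
    [I : u], and its cokernel is [S/(I + (u))]. *)
Lemma cone_resolves (I J : R -> Prop) (u : R) :
  homogeneous_ideal I -> resolves I F -> resolves J G ->
  (forall p, J p <-> I (u * p)) -> chain_map phi ->
  (forall k, I ((u *: aug G - phi 0%N *m aug F) k ord0)) ->
  resolves (adjoin I u) cone.
Proof.
move=> hI rF rG IJ cphi aphi.
have aphi' r (b : 'M_(r, rk G 0)) k :
    I ((b *m (u *: aug G - phi 0%N *m aug F)) k ord0) by exact: ideal_mulmx.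
(* A cycle whose second component is a boundary is a boundary: subtracting the
   image of [b'] leaves a cycle of [F]. *)
have exact_at i (a : 'rV_(rk F i.+1)) (b : 'rV_(rk G i)) (b' : 'rV_(rk G i.+1)) :
    b = b' *m diff G i -> a *m diff F i + b *m phi i = 0 ->
    exists w, row_mx a b = w *m cone_diff i.+1.
  move=> -> E; case: rF => _ _ ex.
  have /ex [a' aE] : (a + b' *m phi i.+1) *m diff F i = 0.
    by rewrite mulmxDl -mulmxA -cphi mulmxA.
  exists (row_mx a' (- b')); rewrite /= mul_row_block mulmx0 add0r mulNmx.
  by rewrite -aE addrK mulmxN mulNmx opprK.
split.
- move=> f; case: rF => + _ _ => /(_ f) [v Iv].
  by exists v, 0; rewrite mul0r subr0.
- move=> /= v; split=> [[c Ic]|[w ->]].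
    have [b Jb] : exists b : 'rV_(rk G 0), J (c - (b *m aug G) ord0 ord0).
      by case: rG => + _ _; apply.
    case: rF => _ ex _.
    have /ex [a aE] : I (((v - b *m phi 0%N) *m aug F) ord0 ord0).
      have -> : (v - b *m phi 0%N) *m aug F =
          v *m aug F - u *: (b *m aug G)
          + b *m (u *: aug G - phi 0%N *m aug F).
        by rewrite mulmxBr mulmxBl -mulmxA -scalemxAr addrA subrK.
      rewrite mxE; apply: (idealD hI) => //.
      have -> : (v *m aug F - u *: (b *m aug G)) ord0 ord0 =
          ((v *m aug F) ord0 ord0 - c * u) + u * (c - (b *m aug G) ord0 ord0).
        rewrite mxBE [X in _ - X]mxE mulrBr [c * u]mulrC.
        by rewrite addrA subrK.
      by apply: (idealD hI) => //; apply/IJ.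
    exists (row_mx a b); rewrite mul_row_col -aE subrK //.
  rewrite -[w]hsubmxK mul_row_col; set a := lsubmx w; set b := rsubmx w.
  exists ((b *m aug G) ord0 ord0).
  have -> : ((a *m diff F 0 + b *m phi 0%N) *m aug F) ord0 ord0
      - (b *m aug G) ord0 ord0 * u =
      (a *m (diff F 0 *m aug F) - b *m (u *: aug G - phi 0%N *m aug F)) ord0 ord0.
    rewrite mulmxDl mulmxBr -scalemxAr !mulmxA !mxBE.
    by rewrite [X in X - _]mxE [X in _ = _ - (X - _)]mxE; ring.
  rewrite mxBE; apply: (idealB hI) => //.
  by apply: (ideal_mulmx _ hI) => k; apply: (diff_aug rF).
- case=> [|i] /= v; rewrite -[v]hsubmxK; set a := lsubmx v; set b := rsubmx v.
    rewrite mul_row_col; split=> [E|[w]].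
      have /IJ Jb : I (u * (b *m aug G) ord0 ord0).
        have -> : u * (b *m aug G) ord0 ord0 =
            (b *m (u *: aug G - phi 0%N *m aug F)) ord0 ord0
            - (a *m (diff F 0 *m aug F)) ord0 ord0.
          rewrite -mxBE mulmxBr -scalemxAr !mulmxA -addrA -opprD -mulmxDl.
          by rewrite [b *m _ + _]addrC E mul0mx subr0 [RHS]mxE.
        apply: (idealB hI) => //.
        by apply: (ideal_mulmx _ hI) => k; apply: (diff_aug rF).
      case: rG => _ ex _; have [b' bE] := proj1 (ex b) Jb.
      exact: exact_at bE E.
    rewrite -[w]hsubmxK mul_row_block mulmx0 add0r => /eq_row_mx [-> ->].
    rewrite mulmxDl -mulmxA (diff_diff rF) mulmx0 add0r mulmxN mulNmx.
    by rewrite -!mulmxA cphi subrr.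
  rewrite mul_row_block mulmx0 add0r; split=> [E|[w]].
    have [E1 E2] : a *m diff F i.+1 + b *m phi i.+1 = 0 /\ b *m - diff G i = 0.
      by apply: eq_row_mx; rewrite E row_mx0.
    case: rG => _ _ ex.
    have /ex [b' bE] : b *m diff G i = 0.
      by apply/eqP; rewrite -oppr_eq0 -mulmxN E2.
    exact: exact_at bE E1.
  rewrite -[w]hsubmxK mul_row_block mulmx0 add0r => /eq_row_mx [-> ->].
  rewrite mulmxDl -mulmxA (diff_diff rF) mulmx0 add0r mulmxN mulNmx.
  rewrite -!mulmxA cphi subrr mulmxN mulNmx opprK -mulmxA (diff_diff rG) mulmx0.
  by rewrite row_mx0.
Qed.

End Cone.

(** The hypotheses give [J = I : u = I : (u * w)].  Multiplying a lift of
    multiplication by [u] by [w] yields a lift of multiplication by [u * w] that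
    vanishes modulo the variables, so the cone is minimal and nothing cancels
    between the Betti numbers of its two parts. *)
Lemma adjoin_resolution (I J : R -> Prop) (F G : free_complex K N)
    (u w : R) (d e : nat) :
  homogeneous_ideal I ->
  minimal_graded_free_resolution I F -> minimal_graded_free_resolution J G ->
  u \is d.-homog -> w \is e.-homog -> w@_0%MM = 0 ->
  (forall p, J p -> I (u * p)) -> (forall p, I (u * w * p) -> J p) ->
  exists2 H, minimal_graded_free_resolution (adjoin I (u * w)) H &
    forall i j, betti_support H i j <->
      betti_support F i j \/
      exists2 i', i = i'.+1 & betti_support G i' (j - (d + e)%N%:Z).
Proof.
move=> hI [gF rF mF] [gG rG mG] hu hw w0 JI IJ.
have [phi [gphi aphi cphi]] := comparison hI gG rG gF rF hu JI.
pose wphi i := w *: phi i.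
exists (cone (d + e) wphi); last exact: betti_support_cone.
split.
- apply: graded_cone => // i k l.
  have := graded_scalemx hw (gphi i) k l.
  by rewrite -addrA -PoszD.
- apply: (@cone_resolves _ _ _ _ I J) => //.
  + by move=> p; split=> [/JI Ip|/IJ//]; rewrite [u * w]mulrC -mulrA; apply: idealM.
  + by move=> i; rewrite /wphi -scalemxAl -cphi scalemxAr.
  + move=> k; have -> : (u * w) *: aug G - wphi 0%N *m aug F =
        w *: (u *: aug G - phi 0%N *m aug F).
      by rewrite scalerBr scalerA [w * u]mulrC -scalemxAl.
    by rewrite mxE; apply: (idealM hI).
- by apply: minimal_cone => // i; apply: radical_scalemx.
Qed.

End MappingCone.

(** * Projective dimension and regularity of an enlarged ideal *)

Section PdReg.
Variables (K : fieldType) (N : nat).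
Local Notation R := {mpoly K[N]}.
Implicit Types (I J : R -> Prop).

(** Refers to a single minimal resolution, which is what the mapping cone
    provides; [min_pd_reg_has] passes to all of them. *)
Definition min_pd_reg I (p r : nat) : Prop :=
  exists2 F : free_complex K N, minimal_graded_free_resolution I F &
    is_max (fun i : nat => exists j, betti_support F i j) p /\
    is_max (fun c : int => exists i j, betti_support F i j /\ c = j - i%:Z) r%:Z.

Lemma is_max_ext (d : Order.disp_t) (T : porderType d) (P Q : T -> Prop) x :
  (forall y, P y <-> Q y) -> is_max P x -> is_max Q x.
Proof. by move=> PQ [/PQ Qx ub]; split=> // y /PQ; apply: ub. Qed.

Lemma min_pd_reg_has I p r : homogeneous_ideal I -> min_pd_reg I p r ->
  has_pd I p /\ has_reg I r%:Z.
Proof.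
move=> hI [F mF [pdF regF]].
have suppE G i j : minimal_graded_free_resolution I G ->
    betti G i j <> 0%N <-> betti_support F i j.
  by move=> mG; rewrite bettiP; split; apply: betti_support_sub hI _ _.
split; split; [by exists F| |by exists F|] => G mG.
  apply: is_max_ext pdF => i.
  by split=> -[j H]; exists j; apply/(suppE _ _ _ mG).
apply: is_max_ext regF => c.
by split=> -[i [j [H E]]]; exists i, j; split=> //; apply/(suppE _ _ _ mG).
Qed.

Lemma min_pd_reg_ext I J p r : (forall f, I f <-> J f) ->
  min_pd_reg I p r -> min_pd_reg J p r.
Proof.
move=> IJ [F [gF [r1 r2 r3] mF] pr]; exists F => //; split=> //; split=> //.
  by move=> f; have [v /IJ] := r1 f; exists v.
by move=> v; rewrite -IJ.
Qed.

Lemma min_pd_reg_adjoin I J (u w : R) (d e p r p' r' : nat) :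
  homogeneous_ideal I -> u \is d.-homog -> w \is e.-homog -> (0 < e)%N ->
  (forall f, J f -> I (u * f)) -> (forall f, I (u * w * f) -> J f) ->
  min_pd_reg I p r -> min_pd_reg J p' r' ->
  min_pd_reg (adjoin I (u * w)) (maxn p p'.+1) (maxn r (r' + (d + e).-1)).
Proof.
move=> hI hu hw e0 JI IJ [F mF [[[j pj] pmax] [[i' [j' [rj rE]]] rmax]]].
move=> [G mG [[[k pk] pmax'] [[l [k' [rk rE']]] rmax']]].
have w0 : w@_0%MM = 0.
  apply: (dhomog_nemf_coeff hw); change (mdeg (0%MM : 'X_{1..N}) != e).
  by rewrite mdeg0; lia.
have [H mH supp] := adjoin_resolution hI mF mG hu hw w0 JI IJ.
exists H => //; split; split.
- case: leqP => _; [exists (k + (d + e)%N%:Z) | exists j]; apply/supp; last by left.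
  by right; exists p' => //; rewrite addrK.
- move=> i [x /supp[px|[i1 -> px]]]; rewrite leEnat leq_max.
    by rewrite -leEnat pmax //; exists x.
  by rewrite ltnS orbC -leEnat pmax' //; eexists; apply: px.
- case: leqP => _; last by exists i', j'; split=> //; apply/supp; left.
  exists l.+1, (k' + (d + e)%N%:Z); split; last by lia.
  by apply/supp; right; exists l => //; rewrite addrK.
- move=> c [i [x [/supp[px|[i1 -> px]] ->]]].
    have : x - i%:Z <= r%:Z by apply: rmax; exists i, x.
    by lia.
  have : x - (d + e)%N%:Z - i1%:Z <= r'%:Z.
    by apply: rmax'; exists i1, (x - (d + e)%N%:Z).
  by lia.
Qed.

Definition zero_complex : free_complex K N :=
  @FreeComplex K N (fun i => (i == 0)%N) (fun _ _ => 0) (fun _ => 0) (const_mx 1).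

Lemma min_pd_reg_zero : min_pd_reg (fun f => f = 0) 0 0.
Proof.
exists zero_complex.
  split.
  - split=> [i k l|k]; first by left; rewrite mxE.
    by right; exists 0%N; rewrite ?mxE ?dhomog1.
  - split=> [f|v|i v] /=.
    + by exists (const_mx f); rewrite mxE big_ord1 !mxE mulr1 subrr.
    + rewrite mxE big_ord1 [const_mx _ _ _]mxE mulr1.
      split=> [v0|[w ->]]; last by rewrite mulmx0 mxE.
      by exists 0; apply/rowP => k; rewrite mulmx0 !ord1 v0 mxE.
    + rewrite mulmx0; split=> // _.
      by exists 0; apply/rowP => -[].
  - by move=> i k l; rewrite mxE mcoeff0.
split; split.
- by exists 0, ord0.
- by case=> [|i] // [j [[]]].
- by exists 0%N, 0; split=> //; exists ord0.
- by move=> c [[|i] [j [[[k hk]] //= <- ->]]].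
Qed.

End PdReg.

(** * Squarefree monomial ideals *)

Section SquarefreeIdeals.
Variables (K : fieldType) (V : finType).
Local Notation R := {mpoly K[#|V|]}.
Implicit Types (P Q : {set V} -> bool) (S T W : {set V}) (m : 'X_{1..#|V|}).

Definition vsupp m : {set V} := [set v | m (enum_rank v) != 0%N].

Definition monom S : R := \prod_(v in S) 'X_(enum_rank v).

Definition set_mnm S : 'X_{1..#|V|} := (\sum_(v in S) U_(enum_rank v))%MM.

Lemma monomE S : monom S = 'X_[set_mnm S].
Proof. by rewrite /set_mnm (big_morph _ (@mpolyXD _ K) (mpolyX0 _ _)). Qed.

Lemma vsuppD m m' : vsupp (m + m') = vsupp m :|: vsupp m'.
Proof. by apply/setP => v; rewrite !inE mnmDE addn_eq0 negb_and. Qed.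

Lemma set_mnmE S v : set_mnm S (enum_rank v) = (v \in S).
Proof.
rewrite /set_mnm mnm_sumE; under eq_bigr => u _.
  rewrite mnmE (inj_eq enum_rank_inj); over.
have [vS|vS] := boolP (v \in S).
  by rewrite (bigD1 v) //= eqxx big1 // => u /andP[_ /negPf->].
by rewrite big1 // => u uS; case: eqP => // uv; rewrite -uv uS in vS.
Qed.

Lemma vsupp_set_mnm S : vsupp (set_mnm S) = S.
Proof. by apply/setP => v; rewrite inE set_mnmE; case: (v \in S). Qed.

Lemma monom_homog S : monom S \is #|S|.-homog.
Proof.
rewrite monomE dhomogX; apply/eqP; transitivity (mdeg (set_mnm S)) => //.
rewrite /set_mnm mdeg_sum -[RHS]sum1_card.
by apply: eq_bigr => v _; rewrite mdeg1.
Qed.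

Lemma monomU S W : [disjoint S & W] -> monom (S :|: W) = monom S * monom W.
Proof.
by move=> SW; rewrite /monom -bigU //; apply: eq_bigl => v; rewrite inE.
Qed.

Lemma sub_monom_dvd S m : S \subset vsupp m ->
  'X_[m] = 'X_[m - set_mnm S] * monom S :> R.
Proof.
move=> /subsetP sub; rewrite monomE -mpolyXD submK //.
apply/mnm_lepP => i; rewrite -[i]enum_valK set_mnmE.
by case: (boolP (_ \in S)) => // /sub; rewrite inE lt0n.
Qed.

Definition upclosed P : Prop := forall S T, S \subset T -> P S -> P T.

(** Recording a squarefree monomial ideal by the supports of its monomials,
    instead of by generators, turns colon ideals by monomials into unions of
    vertex sets. *)
Definition sqfree_ideal P (f : R) : Prop :=
  forall m, m \in msupp f -> P (vsupp m).

Lemma sqfree_ideal_homogeneous P :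
  upclosed P -> homogeneous_ideal (sqfree_ideal P).
Proof.
move=> upP; split=> [m|p q Ip Iq m|p q Iq m|e p Ip m].
- by rewrite msupp0.
- by move/msuppD_le; rewrite mem_cat => /orP[/Ip|/Iq].
- move/msuppM_le/allpairsP => [[m1 m2] /= [_ /Iq Pm ->]].
  by apply: upP Pm; rewrite vsuppD subsetUr.
- rewrite mcoeff_msupp mcoeff_gcomp; case: ifP; rewrite ?eqxx // => _.
  by rewrite -mcoeff_msupp => /Ip.
Qed.

(** The colon ideal by the monomial of [S]. *)
Lemma sqfree_ideal_monomM P S f :
  sqfree_ideal P (monom S * f) <-> sqfree_ideal (fun T => P (S :|: T)) f.
Proof.
rewrite monomE mulrC; split=> H m; last first.
  rewrite (perm_mem (msuppMX _ _)) => /mapP[m' /H Pm ->].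
  by rewrite vsuppD vsupp_set_mnm.
move=> mf; have := H (set_mnm S + m)%MM; rewrite vsuppD vsupp_set_mnm.
by apply; rewrite (perm_mem (msuppMX _ _)) map_f.
Qed.

(** Monomial ideals are compared through this: an inclusion only has to be
    checked on monomials. *)
Lemma ideal_mem_of_monomials (I : R -> Prop) f :
  I 0 -> (forall p q, I p -> I q -> I (p + q)) ->
  (forall p q, I q -> I (p * q)) ->
  (forall m, m \in msupp f -> I 'X_[m]) -> I f.
Proof.
move=> I0 ID IM Im; rewrite [f]mpolyE big_seq.
elim/big_ind: _ => // m /Im Xm.
by rewrite -mul_mpolyC; apply: IM.
Qed.

Lemma adjoin_monomE P S f : upclosed P ->
  adjoin (sqfree_ideal P) (monom S) f <->
  sqfree_ideal (fun T => P T || (S \subset T)) f.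
Proof.
move=> upP; have hI := sqfree_ideal_homogeneous upP.
have upQ : upclosed (fun T => P T || (S \subset T)).
  move=> A B AB /orP[/(upP _ _ AB)->//|SA].
  by rewrite (subset_trans SA AB) orbT.
have hQ := sqfree_ideal_homogeneous upQ.
split=> [[c Ic]|].
  rewrite -[f](subrK (c * monom S)); apply: (idealD hQ).
    by move=> m /Ic ->.
  apply: (idealM hQ) => m; rewrite monomE msuppX inE => /eqP->.
  by rewrite vsupp_set_mnm subxx orbT.
move=> Qf; apply: ideal_mem_of_monomials => [|p q [c Ic] [c' Ic']|p q [c Ic]|m /Qf].
- by exists 0; rewrite mul0r subr0; apply: (ideal0 hI).
- by exists (c + c'); rewrite mulrDl opprD addrACA; apply: (idealD hI).
- by exists (p * c); rewrite -mulrA -mulrBr; apply: (idealM hI).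
case/orP=> [Pm|/sub_monom_dvd->].
  exists 0; rewrite mul0r subr0 => m'; rewrite msuppX inE => /eqP->//.
by exists 'X_[m - set_mnm S]; rewrite subrr; apply: (ideal0 hI).
Qed.

Lemma ideal_gen_monomE (U : finType) (A : U -> {set V}) f :
  ideal_gen (fun t => monom (A t)) f <->
  sqfree_ideal (fun T => [exists t, A t \subset T]) f.
Proof.
have upQ : upclosed (fun T => [exists t, A t \subset T]).
  by move=> B C BC /existsP[t AB]; apply/existsP; exists t; apply: subset_trans BC.
have hQ := sqfree_ideal_homogeneous upQ.
split=> [[c ->]|Qf].
  elim/big_ind: _ => [|p q|t _]; [exact: (ideal0 hQ)|exact: (idealD hQ)|].
  apply: (idealM hQ) => m; rewrite monomE msuppX inE => /eqP->.
  by apply/existsP; exists t; rewrite vsupp_set_mnm.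
apply: ideal_mem_of_monomials => [|p q [c ->] [c' ->]|p q [c ->]|m /Qf].
- by exists (fun _ => 0); rewrite big1 // => t _; rewrite mul0r.
- exists (fun t => c t + c' t); rewrite -big_split.
  by apply: eq_bigr => t _; rewrite mulrDl.
- exists (fun t => p * c t); rewrite mulr_sumr.
  by apply: eq_bigr => t _; rewrite mulrA.
case/existsP=> t /sub_monom_dvd->.
exists (fun t' => if t' == t then 'X_[m - set_mnm (A t)] else 0).
rewrite (bigD1 t) //= eqxx big1 ?addr0 // => t' /negPf->.
by rewrite mul0r.
Qed.

Definition sqfree_pd_reg P p r := min_pd_reg (sqfree_ideal P) p r.

(** The case of [adjoin_resolution] where [u] and [w] are the monomials of [S]
    and [W].  The two conditions on [Q] say that it describes the colon ideal of
    [P] by the monomial of [S] as well as by that of [S :|: W]. *)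
Lemma sqfree_pd_reg_adjoin P Q S W p r p' r' :
  upclosed P -> [disjoint S & W] -> W != set0 ->
  (forall T, Q T -> P (S :|: T)) -> (forall T, P (S :|: W :|: T) -> Q T) ->
  sqfree_pd_reg P p r -> sqfree_pd_reg Q p' r' ->
  sqfree_pd_reg (fun T => P T || (S :|: W \subset T))
    (maxn p p'.+1) (maxn r (r' + #|S :|: W|.-1)).
Proof.
move=> upP SW W0 QP PQ resP resQ.
apply: min_pd_reg_ext => [f|]; first exact: adjoin_monomE.
rewrite monomU // cardsU disjoint_setI0 // cards0 subn0.
apply: min_pd_reg_adjoin resP resQ; rewrite ?monom_homog ?card_gt0 //.
- exact: sqfree_ideal_homogeneous.
- move=> f Qf; apply/sqfree_ideal_monomM => m /Qf; exact: QP.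
- by move=> f; rewrite -monomU // => /sqfree_ideal_monomM H m /H; apply: PQ.
Qed.

Lemma sqfree_pd_reg_empty : sqfree_pd_reg (fun _ => false) 0 0.
Proof.
apply: min_pd_reg_ext (min_pd_reg_zero K #|V|) => f.
split=> [-> m|H]; first by rewrite msupp0.
apply: msuppnil0; case E: (msupp f) => [//|m s].
by have := H m; rewrite E mem_head => /(_ isT).
Qed.

End SquarefreeIdeals.

(** * Ideals generated by windows *)

Section WindowIdeals.
Variables (K : fieldType) (V : finType) (pos : V -> nat).
Implicit Types (T : {set V}) (ws : seq (nat * nat)).

(** Half-open, so that consecutive windows concatenate and an empty window
    gives the monomial 1. *)
Definition win (a b : nat) : {set V} := [set v | a <= pos v < b]%N.

Definition covers ws T : bool := has (fun w => win w.1 w.2 \subset T) ws.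

Definition win_pd_reg ws p r := sqfree_pd_reg K (covers ws) p r.

Lemma covers_upclosed ws : upclosed (covers ws).
Proof.
by move=> S T ST /hasP[w wws wS]; apply/hasP; exists w; rewrite // (subset_trans wS).
Qed.

Lemma winU a b c : (a <= b <= c)%N -> win a b :|: win b c = win a c.
Proof. by move=> abc; apply/setP => v; rewrite !inE; lia. Qed.

Lemma win_disjoint a b c : [disjoint win a b & win b c].
Proof.
by rewrite -setI_eq0; apply/eqP/setP => v; rewrite !inE; lia.
Qed.

Lemma card_winU a b c : (a <= b <= c)%N ->
  #|win a c| = (#|win a b| + #|win b c|)%N.
Proof.
move=> abc; rewrite -(winU abc) cardsU disjoint_setI0 ?cards0 ?subn0 //.
exact: win_disjoint.
Qed.

Lemma win_pd_reg_ext ws ws' p r :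
  (forall T, covers ws T = covers ws' T) -> win_pd_reg ws p r -> win_pd_reg ws' p r.
Proof.
by move=> E; apply: min_pd_reg_ext => f; split=> H m /H; rewrite E.
Qed.

(** The new window [[a, c)] is split into [[a, b)] and the part [[b, c)] by
    which the lift is multiplied.  The two conditions compare [ws'] with the
    colon ideals of [ws] by these windows: an element of [ws'] together with
    [[a, b)] contains an element of [ws], and an element of [ws] with [[a, c)]
    removed contains an element of [ws']. *)
Lemma win_pd_reg_cons ws ws' a b c p r p' r' :
  (a <= b <= c)%N -> win b c != set0 ->
  (forall w', w' \in ws' -> exists2 w, w \in ws &
     forall j, (w.1 <= j < w.2)%N -> (a <= j < b)%N \/ (w'.1 <= j < w'.2)%N) ->
  (forall w, w \in ws -> exists2 w', w' \in ws' &
     forall j, (w'.1 <= j < w'.2)%N -> (w.1 <= j < w.2)%N /\ ~ (a <= j < c)%N) ->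
  win_pd_reg ws p r -> win_pd_reg ws' p' r' ->
  win_pd_reg ((a, c) :: ws) (maxn p p'.+1) (maxn r (r' + #|win a c|.-1)).
Proof.
move=> abc bc0 glue cut resP resQ.
apply: (min_pd_reg_ext
  (I := sqfree_ideal (fun T => covers ws T || (win a c \subset T)))).
  by move=> f; split=> H m /H; rewrite /= orbC.
rewrite -(winU abc); apply: sqfree_pd_reg_adjoin resP resQ => //.
- exact: covers_upclosed.
- exact: win_disjoint.
- move=> T /hasP[w' /glue[w wws sub] /subsetP w'T].
  apply/hasP; exists w => //; apply/subsetP => v; rewrite !inE => /sub[-> //|vw'].
  by rewrite w'T ?inE ?orbT.
- move=> T /hasP[w /cut[w' w'ws sub]]; rewrite (winU abc) => /subsetP wT.
  apply/hasP; exists w' => //; apply/subsetP => v; rewrite !inE => /sub[vw /negP nvac].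
  by have := wT v; rewrite !inE vw (negPf nvac) => /(_ isT).
Qed.

Lemma win_pd_reg_nil : win_pd_reg [::] 0 0.
Proof. exact: sqfree_pd_reg_empty. Qed.

Lemma win_pd_reg1 a c : win a c != set0 -> win_pd_reg [:: (a, c)] 1 #|win a c|.-1.
Proof.
move=> ac0; have ac : (a <= a <= c)%N.
  by have /set0Pn[v] := ac0; rewrite inE; lia.
have := @win_pd_reg_cons [::] [::] a a c 0 0 0 0 ac ac0.
by rewrite !max0n; apply => //; apply: win_pd_reg_nil.
Qed.

(** For the square of the broom, [(0, 3)] is the closed neighborhood of the
    [x_i] and [(j, j + 5)] that of [y_(j+2)]. *)
Definition inner_windows (k : nat) : seq (nat * nat) :=
  (0, 3)%N :: [seq (j, j + 5)%N | j <- iota 1 (k - 3)].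

Lemma inner_windowsP k w :
  reflect (w = (0, 3)%N \/ exists2 j, (1 <= j <= k - 3)%N & w = (j, j + 5)%N)
          (w \in inner_windows k).
Proof.
rewrite inE; apply: (iffP orP) => [[/eqP|/mapP[j]]|[->|[j jk ->]]].
- by left.
- by rewrite mem_iota => jk ->; right; exists j => //; lia.
- by left.
- by right; apply/mapP; exists j => //; rewrite mem_iota; lia.
Qed.

Lemma inner_windows3 k : (k <= 3)%N -> inner_windows k = [:: (0, 3)%N].
Proof. by rewrite /inner_windows => /eqP->. Qed.

Lemma inner_windowsS k T : (3 <= k)%N ->
  covers (inner_windows k.+1) T = covers ((k - 2, k + 3)%N :: inner_windows k) T.
Proof.
move=> k3; rewrite /covers; apply: eq_has_r => w.
rewrite [RHS]inE; apply/inner_windowsP/orP => [[->|[j jk ->]]|[/eqP->|]].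
- by right; apply/inner_windowsP; left.
- have [->|jk'] := eqVneq j (k - 2)%N; first by left; apply/eqP; congr pair; lia.
  by right; apply/inner_windowsP; right; exists j => //; lia.
- by right; exists (k - 2)%N; [lia|congr pair; lia].
- case/inner_windowsP=> [->|[j jk ->]]; first by left.
  by right; exists j => //; lia.
Qed.

(** Removing [[k, k + 3)] from the windows [(j, j + 5)] leaves those with
    [j <= k - 6] intact, and shortens [(k - 3, k + 2)] to [(k - 3, k)], which is
    contained in what remains of the others.  For [k = 3] the window [(0, 3)]
    plays the role of [(k - 3, k)]. *)
Lemma end_pd_reg_step k p r p' r' :
  (3 <= k)%N -> win (k + 2) (k + 3) != set0 ->
  win_pd_reg (inner_windows k) p r ->
  win_pd_reg ((k - 3, k)%N :: inner_windows (k - 3)) p' r' ->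
  win_pd_reg ((k, k + 3)%N :: inner_windows k)
    (maxn p p'.+1) (maxn r (r' + #|win k (k + 3)|.-1)).
Proof.
move=> k3 neq0; apply: win_pd_reg_cons neq0 _ _; first by lia.
  move=> w'; rewrite inE => /orP[/eqP->|w'k]; last first.
    exists w' => [|j]; last by right.
    case/inner_windowsP: w'k => [->|[i ik ->]]; apply/inner_windowsP; first by left.
    by right; exists i => //; lia.
  have [->|k3'] := eqVneq k 3.
    by exists (0, 3)%N => [|j /=]; [apply/inner_windowsP; left | lia].
  exists (k - 3, k - 3 + 5)%N => [|j /=]; last by lia.
  by apply/inner_windowsP; right; exists (k - 3)%N => //; lia.
move=> w /inner_windowsP[->|[i ik ->]].
  exists (0, 3)%N => [|j /=]; last by lia.
  by rewrite inE; apply/orP; right; apply/inner_windowsP; left.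
have [ik'|ik'] := leqP i (k - 6).
  exists (i, i + 5)%N => [|j /=]; last by lia.
  by rewrite inE; apply/orP; right; apply/inner_windowsP; right; exists i => //; lia.
by exists (k - 3, k)%N => [|j /=]; [rewrite inE eqxx | lia].
Qed.
Section Recursion.
Variable m : nat.
Hypothesis card_win1 : forall j, (0 < j <= m)%N -> #|win j j.+1| = 1%N.

Lemma card_win a c : (0 < a <= c)%N -> (c <= m.+1)%N -> #|win a c| = (c - a)%N.
Proof.
case/andP=> a0; elim: c => [|c IH] ac cm; first by lia.
have [<-|ca] := eqVneq a c.+1.
  by rewrite subnn; apply: eq_card0 => v; rewrite !inE; case: ltngtP.
by rewrite (@card_winU a c c.+1) ?IH ?card_win1; lia.
Qed.

Variable n : nat.
Hypothesis card_win01 : #|win 0 1| = n.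

Lemma card_win0 c : (0 < c <= m.+1)%N -> #|win 0 c| = (n + c.-1)%N.
Proof.
by move=> cm; rewrite (@card_winU 0 1 c) ?card_win01 ?card_win; lia.
Qed.

Hypotheses (n0 : (0 < n)%N) (m4 : (4 <= m)%N).

Lemma win_neq0 a c : (a < c <= m.+1)%N -> win a c != set0.
Proof.
move=> ac; rewrite -card_gt0; case: a ac => [|a] ac.
  by rewrite card_win0; lia.
by rewrite card_win; lia.
Qed.

(** The window [(k - 2, k + 3)] is added to [inner_windows k].  What is left
    of [(k - 3, k + 2)], or of [(0, 3)] when [k = 3], is block [k - 3], so the
    colon ideal is generated by that block and by the windows avoiding it, which
    are those of [inner_windows (k - 5)] if [k >= 6] and none otherwise. *)
Lemma inner_pd_reg k : (0 < k < m)%N ->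
  win_pd_reg (inner_windows k) ((k + 2) %/ 3) (n + 2 * ((k + 2) %/ 3)).-1.
Proof.
elim/ltn_ind: k => -[//|k] IH km.
have [k3|k3] := leqP k.+1 3.
  rewrite inner_windows3 //.
  have -> : ((k.+1 + 2) %/ 3 = 1)%N by lia.
  have := @win_pd_reg1 0 3; rewrite card_win0; last by lia.
  have -> : (n + 3.-1).-1 = (n + 2 * 1).-1 by lia.
  by apply; apply: win_neq0; lia.
apply: (win_pd_reg_ext (ws := (k - 2, k + 3)%N :: inner_windows k)) => [T|].
  by rewrite inner_windowsS.
have [ws' [p' [r' [res' [p'E r'E] [glue cut]]]]] : exists ws' p' r',
    [/\ win_pd_reg ws' p' r',
        maxn ((k + 2) %/ 3) p'.+1 = ((k.+1 + 2) %/ 3)%N /\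
        maxn (n + 2 * ((k + 2) %/ 3)).-1 (r' + 4) =
          (n + 2 * ((k.+1 + 2) %/ 3)).-1
      & (forall w', w' \in ws' -> exists2 w, w \in inner_windows k &
          forall j, (w.1 <= j < w.2)%N ->
            (k - 2 <= j < k + 2)%N \/ (w'.1 <= j < w'.2)%N) /\
        (forall w, w \in inner_windows k -> exists2 w', w' \in ws' &
          forall j, (w'.1 <= j < w'.2)%N ->
            (w.1 <= j < w.2)%N /\ ~ (k - 2 <= j < k + 3)%N)].
  have glue0 : exists2 w, w \in inner_windows k & forall j,
      (w.1 <= j < w.2)%N -> (k - 2 <= j < k + 2)%N \/ (k - 3 <= j < k - 2)%N.
    have [->|k3'] := eqVneq k 3.
      by exists (0, 3)%N => [|j /=]; [apply/inner_windowsP; left | lia].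
    exists (k - 3, k - 3 + 5)%N => [|j /=]; last by lia.
    by apply/inner_windowsP; right; exists (k - 3)%N => //; lia.
  have [k5|k5] := leqP k 5.
    exists [:: (k - 3, k - 2)%N], 1%N, #|win (k - 3) (k - 2)|.-1; split.
    + by apply/win_pd_reg1/win_neq0; lia.
    + have [k3'|k3'] := eqVneq k 3.
        by rewrite k3' /= card_win01; lia.
      by rewrite card_win; lia.
    + split=> [w'|w]; first by rewrite inE => /eqP->.
      move=> wk; exists (k - 3, k - 2)%N; rewrite ?inE // => j /=.
      by case/inner_windowsP: wk => [->|[i ik ->]] /=; lia.
  have resk : win_pd_reg (inner_windows (k - 5)) ((k - 5 + 2) %/ 3)
      (n + 2 * ((k - 5 + 2) %/ 3)).-1 by apply: IH; lia.
  have ineq0 : (k - 3 <= k - 3 <= k - 2)%N by lia.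
  have neq0 : win (k - 3) (k - 2) != set0 by apply: win_neq0; lia.
  have res' := win_pd_reg_cons ineq0 neq0 _ _ resk resk.
  do 3!eexists; split; [apply: res' | |].
  + by move=> w' w'k; exists w' => // j; right.
  + move=> w wk; exists w => // j; split=> //.
    by move: wk => /inner_windowsP[E|[i ik E]]; rewrite E /= in H *; lia.
  + rewrite card_win; lia.
  + split=> [w'|w].
      rewrite inE => /orP[/eqP->//|w'k]; exists w' => [|j]; last by right.
      case/inner_windowsP: w'k => [->|[i ik ->]]; apply/inner_windowsP; first by left.
      by right; exists i => //; lia.
    case/inner_windowsP=> [->|[i ik ->]].
      exists (0, 3)%N => [|j /=]; last by lia.
      by rewrite inE; apply/orP; right; apply/inner_windowsP; left.
    have [ik'|ik'] := leqP i (k - 8).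
      exists (i, i + 5)%N => [|j /=]; last by lia.
      by rewrite inE; apply/orP; right; apply/inner_windowsP; right; exists i => //; lia.
    by exists (k - 3, k - 2)%N => [|j /=]; [rewrite inE eqxx | lia].
have resk : win_pd_reg (inner_windows k) ((k + 2) %/ 3)
    (n + 2 * ((k + 2) %/ 3)).-1 by apply: IH; lia.
have ineq : (k - 2 <= k + 2 <= k + 3)%N by lia.
have neq0 : win (k + 2) (k + 3) != set0 by apply: win_neq0; lia.
have := win_pd_reg_cons ineq neq0 glue cut resk res'.
have -> : #|win (k - 2) (k + 3)|.-1 = 4 by rewrite card_win; lia.
by rewrite p'E r'E.
Qed.

(** For [k <= 2] the final window meets [(0, 3)], and the colon ideal is
    generated by what remains of the latter, the blocks before [k]; for [k = 0]
    the two windows coincide. *)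
Lemma end_pd_reg k : (k <= m - 2)%N ->
  win_pd_reg ((k, k + 3)%N :: inner_windows k)
    ((k + 2) %/ 3).+1 (n + k %/ 3 + (k + 1) %/ 3).+1.
Proof.
elim/ltn_ind: k => k IH km.
have [k2|k2] := leqP k 2; last first.
  have neq0 : win (k + 2) (k + 3) != set0 by apply: win_neq0; lia.
  have res : win_pd_reg (inner_windows k) ((k + 2) %/ 3)
    (n + 2 * ((k + 2) %/ 3)).-1 by apply: inner_pd_reg; lia.
  have := IH (k - 3)%N; rewrite subnK // => /(_ _ _)/(end_pd_reg_step k2 neq0 res).
  rewrite card_win; [|lia|lia].
  have -> : maxn ((k + 2) %/ 3) ((k - 3 + 2) %/ 3).+2 = ((k + 2) %/ 3).+1 by lia.
  set r := maxn _ _; have -> : r = (n + k %/ 3 + (k + 1) %/ 3).+1 by rewrite /r; lia.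
  by apply; lia.
have res1 : win_pd_reg (inner_windows 1) 1 n.+1.
  have -> : n.+1 = (n + 2 * 1).-1 by lia.
  by apply: (@inner_pd_reg 1); lia.
case: k k2 km {IH} => [|k] k2 km.
  apply: (win_pd_reg_ext (ws := inner_windows 1)).
    by move=> T; rewrite /covers /= orbF orbb.
  by rewrite !addn0.
have neq0 : win (k + 3) (k + 4) != set0 by apply: win_neq0; lia.
have ineq : (k + 1 <= k + 3 <= k + 4)%N by lia.
have res0 : win_pd_reg [:: (0, k + 1)%N] 1 #|win 0 (k + 1)|.-1.
  by apply/win_pd_reg1/win_neq0; lia.
have := win_pd_reg_cons ineq neq0 _ _ res1 res0.
rewrite card_win0 ?card_win; try lia.
rewrite !inner_windows3 ?(leqW k2) // -[k.+1]addn1.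
have -> : maxn 1 2 = ((k + 1 + 2) %/ 3).+1 by lia.
set r := maxn _ _; have -> : r = (n + (k + 1) %/ 3 + (k + 1 + 1) %/ 3).+1.
  by rewrite /r; lia.
have -> : (k + 4 = k + 1 + 3)%N by lia.
apply=> [w'|w]; rewrite inE => /eqP->.
  by exists (0, 3)%N; rewrite ?inE // => j /=; lia.
by exists (0, k + 1)%N; rewrite ?inE // => j /=; lia.
Qed.

End Recursion.
End WindowIdeals.

(** * The square of the double broom *)

Section DoubleBroom.
Variables (K : fieldType) (n m s : nat).
Hypotheses (n2 : (2 <= n)%N) (m4 : (4 <= m)%N) (s2 : (2 <= s)%N).
Local Notation V := (broom_vertex n m s).

Definition broom_pos (v : V) : nat :=
  match v with
  | inl (inl _) => 0
  | inl (inr j) => j.+1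
  | inr _ => m.+1
  end.

(** Neighborhoods reach two blocks in both directions; this includes the
    cliques formed by the [x_i] and by the [z_r], each a single block. *)
Lemma closed_nbhd_win (u : V) :
  closed_nbhd (double_broom_sq n m s) u =
  win broom_pos (broom_pos u - 2) (broom_pos u + 3).
Proof.
have eqE (a b : V) : (a == b) =
    match a, b with
    | inl (inl i), inl (inl j) => i == j :> nat
    | inl (inr i), inl (inr j) => i == j :> nat
    | inr i, inr j => i == j :> nat
    | _, _ => false end.
  by case: a b => [[a|a]|a] [[b|b]|b].
apply/setP => v; rewrite !inE eqE /double_broom_sq /broom_sq_edge /=.
case: u v => [[u|u]|u] [[v|v]|v] /=;
  have := ltn_ord u; have := ltn_ord v; lia.
Qed.

Lemma card_broom_x : #|win broom_pos 0 1| = n.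
Proof.
rewrite -[RHS]card_ord -cardsT -(card_imset _ (f := fun i : 'I_n => inl (inl i) : V)).
  apply: eq_card => v; rewrite inE; apply/idP/imsetP => [|[i _ ->] //].
  by case: v => [[i|j]|r] //= _; exists i.
by move=> i j [].
Qed.

Lemma card_broom_y j : (0 < j <= m)%N -> #|win broom_pos j j.+1| = 1%N.
Proof.
case: j => // j jm; rewrite -(cards1 (inl (inr (Ordinal jm)) : V)).
apply: eq_card => v; rewrite !inE.
case: v => [[i|i]|r] //=; last by apply/negbTE; lia.
apply/idP/eqP => [ij|[->] /=]; last by lia.
by congr (inl (inr _)); apply: val_inj => /=; lia.
Qed.

Lemma card_broom_z : #|win broom_pos m.+1 m.+2| = s.
Proof.
rewrite -[RHS]card_ord -cardsT -(card_imset _ (f := fun i : 'I_s => inr i : V)).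
  apply: eq_card => v; rewrite inE; apply/idP/imsetP => [|[i _ ->] /=]; last by lia.
  by case: v => [[i|j]|r] /=; [lia|have := ltn_ord j; lia|exists r].
by move=> i j [].
Qed.

Lemma broom_pos_surj p : (p <= m.+1)%N -> exists v, broom_pos v = p.
Proof.
move=> pm; suff /card_gt0P[v] : (0 < #|win broom_pos p p.+1|)%N.
  by rewrite inE => H; exists v; lia.
have [->|p0] := eqVneq p 0%N; first by rewrite card_broom_x; lia.
have [->|p1] := eqVneq p m.+1; first by rewrite card_broom_z; lia.
by rewrite card_broom_y; lia.
Qed.

(** A neighborhood centered at block [p] contains [(0, 3)] if [p <= 2],
    contains the last three blocks if [p >= m - 1], and is an inner window
    otherwise; the windows themselves occur for [p = 0], [p = m + 1] and
    [p = j + 2]. *)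
Lemma nbhds_cover_windows (T : {set V}) :
  [exists u, closed_nbhd (double_broom_sq n m s) u \subset T] =
  covers broom_pos ((m - 1, m - 1 + 3)%N :: inner_windows (m - 1)) T.
Proof.
have sub a b c d : (forall j, (j <= m.+1)%N -> (a <= j < b)%N -> (c <= j < d)%N) ->
    win broom_pos c d \subset T -> win broom_pos a b \subset T.
  move=> abcd; apply: subset_trans; apply/subsetP => v; rewrite !inE.
  by apply: abcd; case: v => [[i|j]|r] //=; rewrite ltnS ltnW.
apply/existsP/hasP => [[u]|[w wk wT]].
  rewrite closed_nbhd_win => uT.
  have um : (broom_pos u <= m.+1)%N.
    by case: (u) => [[i|j]|r] //=; rewrite ltnS ltnW.
  have [u2|u2] := leqP (broom_pos u) 2.
    exists (0, 3)%N; last by apply: sub uT => /=; lia.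
    by rewrite inE; apply/orP; right; apply/inner_windowsP; left.
  have [um2|um2] := leqP (m - 1) (broom_pos u).
    by exists (m - 1, m - 1 + 3)%N; [rewrite inE eqxx | apply: sub uT => /=; lia].
  exists (broom_pos u - 2, broom_pos u - 2 + 5)%N; last by apply: sub uT => /=; lia.
  rewrite inE; apply/orP; right; apply/inner_windowsP; right.
  by exists (broom_pos u - 2)%N => //; lia.
have [p pm sp] : exists2 p, (p <= m.+1)%N & forall j, (j <= m.+1)%N ->
    (p - 2 <= j < p + 3)%N -> (w.1 <= j < w.2)%N.
  move: wk; rewrite inE => /orP[/eqP->|/inner_windowsP[->|[i ik ->]]] /=.
  - by exists m.+1 => // j; lia.
  - by exists 0%N => // j; lia.
  - by exists (i + 2)%N => [|j]; lia.
have [u uE] := broom_pos_surj pm; exists u.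
by rewrite closed_nbhd_win uE; apply: sub wT.
Qed.

Lemma NI_sqfree f :
  NI K (double_broom_sq n m s) f <->
  sqfree_ideal (covers broom_pos ((m - 1, m - 1 + 3)%N :: inner_windows (m - 1))) f.
Proof.
apply: (iff_trans (ideal_gen_monomE (closed_nbhd (double_broom_sq n m s)) f)).
by split=> H t /H; rewrite nbhds_cover_windows.
Qed.

Lemma NI_homogeneous : homogeneous_ideal (NI K (double_broom_sq n m s)).
Proof.
apply: homogeneous_ideal_ext (fun f => iff_sym (NI_sqfree f)) _.
exact/sqfree_ideal_homogeneous/covers_upclosed.
Qed.

(** One more application of [end_pd_reg_step], to the window that ends with
    the block of the [z_r]: this is the only one whose degree involves [s]. *)
Lemma NI_pd_reg :
  min_pd_reg (NI K (double_broom_sq n m s))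
    ((m - 2) %/ 3 + 2) (n + s + (m - 4) %/ 3 + (m - 3) %/ 3 + 2).
Proof.
apply: min_pd_reg_ext (fun f => iff_sym (NI_sqfree f)) _.
have n0 : (0 < n)%N by lia.
have inner : win_pd_reg K broom_pos (inner_windows (m - 1)) ((m - 1 + 2) %/ 3)
    (n + 2 * ((m - 1 + 2) %/ 3)).-1.
  by apply: (inner_pd_reg K card_broom_y card_broom_x n0 m4); lia.
have ends := end_pd_reg K card_broom_y card_broom_x n0 m4 (k := m - 1 - 3).
have m12 : (m - 1 + 2 = m.+1)%N by lia.
have m13 : (m - 1 + 3 = m.+2)%N by lia.
have z0 : win broom_pos (m - 1 + 2) (m - 1 + 3) != set0.
  by rewrite m12 m13 -card_gt0 card_broom_z; lia.
have cz : #|win broom_pos (m - 1) (m - 1 + 3)| = (s + 2)%N.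
  rewrite (@card_winU _ broom_pos (m - 1) m.+1); last by lia.
  rewrite (card_win card_broom_y) // ?m13 ?card_broom_z; lia.
rewrite subnK in ends; last by lia.
have := end_pd_reg_step _ z0 inner (ends _); rewrite cz.
set p := maxn _ _; set r := maxn _ _.
have -> : p = ((m - 2) %/ 3 + 2)%N by rewrite /p; lia.
have -> : r = (n + s + (m - 4) %/ 3 + (m - 3) %/ 3 + 2)%N by rewrite /r; lia.
by apply; lia.
Qed.

End DoubleBroom.

Theorem theorem4p7 (K : fieldType) (n m s p1 d1 : nat)
    (hn : (2 <= n)%N) (hm : (2 <= m)%N) (hs : (2 <= s)%N)
    (hmd : m%:Z - 4%:Z = (6 * p1 + d1)%N%:Z) (hd : (d1 <= 5)%N) :
  has_reg (NI K (double_broom_sq n m s))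
    (if (d1 == 0)%N || (d1 == 1)%N then (4 * p1 + s + n + 2)%N%:Z
     else if (d1 == 2)%N then (4 * p1 + s + n + 3)%N%:Z
     else if (d1 == 3)%N || (d1 == 4)%N then (4 * p1 + s + n + 4)%N%:Z
     else (4 * p1 + s + n + 5)%N%:Z)
  /\
  has_pd (NI K (double_broom_sq n m s))
    (if (d1 == 0)%N then 2 * p1 + 2
     else if [|| d1 == 1, d1 == 2 | d1 == 3]%N then 2 * p1 + 3
     else 2 * p1 + 4)%N.
Proof.
have mE : (m = 6 * p1 + d1 + 4)%N by lia.
have m4 : (4 <= m)%N by lia.
have [pdNI regNI] :=
  min_pd_reg_has (NI_homogeneous K hn m4 hs) (NI_pd_reg K hn m4 hs).
set r := (X in has_reg _ X); set p := (X in has_pd _ X).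
have -> : r = (n + s + (m - 4) %/ 3 + (m - 3) %/ 3 + 2)%N%:Z.
  by rewrite /r mE; case: d1 hd {hmd mE r p} => [|[|[|[|[|[|]]]]]] //= _; lia.
have -> : p = ((m - 2) %/ 3 + 2)%N.
  by rewrite /p mE; case: d1 hd {hmd mE r p} => [|[|[|[|[|[|]]]]]] //= _; lia.
by split.
Qed.
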